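(* Let $k\geq 1$ and $\gamma\geq 1$ be integers. Every connected graph $G$ with $\gamma^r_k(G)=\gamma$ has order at most $\gamma+\gamma\sum_{p=1}^{k}(2p+1)^{\gamma-1}$. Moreover, for all $k,\gamma\geq 1$ there exists a connected graph $G$ with $\gamma^r_k(G)=\gamma$ and order exactly $\gamma+\gamma\sum_{p=1}^{k}(2p+1)^{\gamma-1}$.
   Context: For a graph $G=(V,E)$ and $k\geq 1$, a set $D\subseteq V$ is distance $k$-dominating if every $v\in V\setminus D$ is at distance at most $k$ from some vertex of $D$. An ordered set $W=\{w_1,\dots,w_r\}$ is a resolving set if for all distinct $u,v\in V\setminus W$ the distance vectors $(d_G(u,w_i))_i$ and $(d_G(v,w_i))_i$ differ. $\gamma^r_k(G)$ is the minimum cardinality of a set that is both resolving and distance $k$-dominating. *)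

(* Defs.v *)
From mathcomp Require Import all_boot.

Set Implicit Arguments.
Unset Strict Implicit.
Unset Printing Implicit Defensive.

Record sgraph := SGraph {
  vertex :> finType;
  adj : rel vertex;
  adj_sym : symmetric adj;
  adj_irrefl : irreflexive adj
}.

Definition connected (G : sgraph) : Prop := forall x y : G, connect (@adj G) x y.

Section Distance.
Variable G : sgraph.

Definition walk (n : nat) (x y : G) : bool :=
  [exists p : n.-tuple G, path (@adj G) x p && (last x p == y)].

(* The least length of a walk from x to y. It is below #|G| whenever x and y
   are connected (gdistP); the value is #|G| when they are not, a case that does
   not occur in a connected graph. *)
Definition gdist (x y : G) : nat := find (fun n => walk n x y) (iota 0 #|G|).

Lemma walkP n (x y : G) :
  reflect (exists p, [/\ path (@adj G) x p, last x p = y & size p = n])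
          (walk n x y).
Proof.
apply: (iffP existsP) => [[p /andP[xp /eqP yp]]|[p [xp yp sp]]].
  by exists p; rewrite size_tuple.
by exists (tcast sp (in_tuple p)); rewrite val_tcast xp yp eqxx.
Qed.

Lemma gdistP (x y : G) : connect (@adj G) x y ->
  [/\ gdist x y < #|G|, walk (gdist x y) x y
    & forall n, walk n x y -> gdist x y <= n].
Proof.
have short n : n < #|G| -> walk n x y -> has (fun n => walk n x y) (iota 0 #|G|).
  by move=> ltn wn; apply/hasP; exists n => //; rewrite mem_iota.
case/connectP => p /shortenP[q xq uq _] yq.
have ltq : size q < #|G| by rewrite -[(size q).+1]/(size (x :: q)) -(card_uniqP uq) max_card.
have hq : has (fun n => walk n x y) (iota 0 #|G|).
  by apply: (short _ ltq); apply/walkP; exists q.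
have ltd : gdist x y < #|G| by rewrite -[X in _ < X](size_iota 0) -has_find.
split=> // [|n wn].
  by move: (nth_find 0 hq); rewrite nth_iota.
rewrite leqNgt; apply/negP => ltn.
by move: (before_find 0 ltn); rewrite nth_iota ?wn // (ltn_trans ltn ltd).
Qed.

Definition kdominating (k : nat) (D : {set G}) : bool :=
  [forall v, (v \notin D) ==> [exists w in D, gdist v w <= k]].

(* W is ordered by the enumeration of G; whether it resolves does not depend on
   the ordering. *)
Definition dist_vector (W : {set G}) (u : G) : seq nat :=
  [seq gdist u w | w <- enum W].

Definition resolving (W : {set G}) : bool :=
  [forall u, forall v, (u \notin W) && (v \notin W) && (u != v) ==>
    (dist_vector W u != dist_vector W v)].

Definition kresdominating (k : nat) (D : {set G}) : bool :=
  resolving D && kdominating k D.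

Lemma kresdominatingT k : kresdominating k [set: G].
Proof.
by apply/andP; split; do ?[apply/forallP => ?]; rewrite !inE.
Qed.

End Distance.

Definition gamma_r (k : nat) (G : sgraph) : nat :=
  #|[arg min_(D < [set: G] | kresdominating k D) #|D|]|.

Lemma gamma_rP k (G : sgraph) :
  (exists2 D : {set G}, kresdominating k D & #|D| = gamma_r k G) /\
  (forall D : {set G}, kresdominating k D -> gamma_r k G <= #|D|).
Proof.
rewrite /gamma_r; case: arg_minnP => [|D resD minD]; first exact: kresdominatingT.
by split=> //; exists D.
Qed.

(* Main.v *)
Require Import Defs.
From HB Require Import structures.
From mathcomp Require Import all_boot.
From mathcomp Require Import zify.

(** Upper bound.  A vertex v outside a resolving, distance-k-dominating set D
    has some w in D at distance p with 1 <= p <= k.  By the triangle inequality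
    d(v, u) lies within p of d(w, u) for each other u in D, so at most
    (2p+1)^(#|D|-1) vertices share the pair (w, p).

    Sharpness.  Make all these distance vectors occur, with the landmarks
    pairwise at distance 2k+1.  The vertices are the lattice points x of some
    pyramid { x | x_i <= k and |x_j - (2k+1)| <= x_i for j <> i }, adjacent when
    their sup-distance is 1.  Coordinate x_j is then the distance to the apex of
    pyramid j: it is 1-Lipschitz along edges, and from every point other than
    that apex some edge decreases it by 1.  A smaller resolving dominating set
    would violate the upper bound, which is strictly increasing in #|D|. *)

(** * Distances in a connected graph and the upper bound on the order *)

Section GraphDistance.
Variable G : sgraph.
Hypothesis conn : connected G.
Implicit Types (x y z : G) (D : {set G}).

Lemma walk_sym n x y : walk n x y -> walk n y x.
Proof.
case/walkP=> p [xp yp sp]; apply/walkP; exists (rev (belast x p)); split.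
- by rewrite -yp rev_path -(eq_path (e := @adj G)) // => a b; apply: adj_sym.
- by case: p xp yp sp => //= a p _ _ _; rewrite rev_cons last_rcons.
- by rewrite size_rev size_belast.
Qed.

Lemma walk_cat m n x y z : walk m x y -> walk n y z -> walk (m + n) x z.
Proof.
case/walkP=> p [xp yp sp] /walkP[q [yq zq sq]]; apply/walkP; exists (p ++ q).
by rewrite cat_path xp last_cat yp size_cat sp sq.
Qed.

Lemma gdist_walk x y : walk (gdist x y) x y.
Proof. by have [] := gdistP (conn x y). Qed.

Lemma gdist_le n x y : walk n x y -> gdist x y <= n.
Proof. by have [_ _] := gdistP (conn x y); apply. Qed.

Lemma gdist_sym x y : gdist x y = gdist y x.
Proof.
by apply/eqP; rewrite eqn_leq !gdist_le //; apply: walk_sym; apply: gdist_walk.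
Qed.

Lemma gdist_triangle y x z : gdist x z <= gdist x y + gdist y z.
Proof. by apply: gdist_le; apply: walk_cat (gdist_walk _ _) (gdist_walk _ _). Qed.

Lemma gdist_gt0 x y : x != y -> 0 < gdist x y.
Proof.
rewrite lt0n; apply: contraNneq => d0; move: (gdist_walk x y); rewrite d0.
by case/walkP=> -[|a p] [_ xy] // _; apply/eqP.
Qed.

Lemma dist_vector_eqP D x y :
  reflect {in D, forall w, gdist x w = gdist y w}
          (dist_vector D x == dist_vector D y).
Proof.
apply: (iffP eqP) => [/eq_in_map xy w wD|xy]; first by apply: xy; rewrite mem_enum.
by apply/eq_in_map => w; rewrite mem_enum; apply: xy.
Qed.

Lemma card_shell D w p : resolving D -> w \in D ->
  #|[set v | v \notin D & gdist v w == p]| <= (2 * p + 1) ^ (#|D| - 1).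
Proof.
move=> resD wD; set A := [set v | _ & _].
have cardDw : #|D| - 1 = #|D :\ w| by rewrite (cardsD1 w D) wD addKn.
(* Adding [p] before subtracting [gdist w u] moves the window of radius [p] to [[0, 2p]]. The value
   [ord0] off [D :\ w] makes [f v] a function supported there, as [card_pffun_on] requires. *)
pose f v : {ffun G -> 'I_(2 * p).+1} :=
  [ffun u => if u \in D :\ w then inord (gdist v u + p - gdist w u) else ord0].
have f_inj : {in A &, injective f}.
  move=> u v; rewrite !inE => /andP[uD /eqP duw] /andP[vD /eqP dvw] fuv.
  apply/eqP; apply: contraT => uv.
  move/forallP: resD => /(_ u) /forallP/(_ v); rewrite uD vD uv /=.
  apply: contraNT => _; apply/dist_vector_eqP => x xD.
  have [->|xw] := eqVneq x w; first by rewrite duw dvw.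
  move/ffunP: fuv => /(_ x) /(congr1 val); rewrite !ffunE !inE xw xD /=.
  have := gdist_triangle w u x; have := gdist_triangle u w x.
  have := gdist_triangle w v x; have := gdist_triangle v w x.
  rewrite (gdist_sym w u) (gdist_sym w v) duw dvw => vt1 vt2 ut1 ut2.
  by rewrite !inordK; lia.
rewrite -(card_in_imset f_inj) cardDw.
have <- : #|'I_(2 * p).+1| = 2 * p + 1 by rewrite card_ord addn1.
rewrite -(card_pffun_on (ord0 : 'I_(2 * p).+1) (mem (D :\ w)) predT).
apply/subset_leq_card/subsetP=> _ /imsetP[v vA ->].
apply/pffun_onP; split=> //; apply/subsetP=> u; rewrite inE ffunE.
by case: ifP => //; rewrite eqxx.
Qed.

Lemma card_le_kresdominating k D : kresdominating k D ->
  #|G| <= #|D| + #|D| * \sum_(1 <= p < k.+1) (2 * p + 1) ^ (#|D| - 1).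
Proof.
case/andP=> resD /forallP domD.
rewrite -(cardsC D) leq_add2l -sum_nat_const big_add1 big_mkord /=.
pose shell w p := [set v | v \notin D & gdist v w == p].
(* Shells are indexed by [p.+1]: a vertex outside [D] is at positive distance from every
   landmark. *)
have le_cover : #|~: D| <= \sum_(w in D) \sum_(p < k) #|shell w p.+1|.
  pose B := \bigcup_(w in D) \bigcup_(p < k) shell w p.+1.
  have sub : ~: D \subset B.
    apply/subsetP=> v; rewrite inE => vD.
    have := domD v; rewrite vD => /existsP[w /andP[wD dvw]].
    have d0 : 0 < gdist v w by apply: gdist_gt0; apply: contraNneq vD => ->.
    have ltk : (gdist v w).-1 < k by lia.
    apply/bigcupP; exists w => //; apply/bigcupP; exists (Ordinal ltk) => //.
    by rewrite inE vD /= prednK.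
  apply: leq_trans (subset_leq_card sub) _.
  have leU (a b : {set G}) m n : #|a| <= m -> #|b| <= n -> #|a :|: b| <= m + n.
    by move=> am bn; apply: leq_trans (leq_add am bn); rewrite cardsU leq_subr.
  apply: (big_rec2 (fun (a : {set G}) n => #|a| <= n)) => [|w n a _ le_an].
    by rewrite cards0.
  apply: (leU) le_an.
  apply: (big_rec2 (fun (a : {set G}) n => #|a| <= n)) => [|p m b _ le_bm].
    by rewrite cards0.
  exact: leU.
apply: leq_trans le_cover _; apply: leq_sum => w wD; apply: leq_sum => p _.
exact: card_shell.
Qed.

End GraphDistance.

(** * The extremal graph on the lattice points of the pyramids *)

Section Pyramids.
Variables k g : nat.

Definition in_pyramid (i : 'I_g) (x : 'I_g -> nat) : bool :=
  (x i <= k) && [forall j, (j != i) ==>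
    (2 * k + 1 <= x j + x i) && (x j <= 2 * k + 1 + x i)].

Lemma in_pyramidP i x :
  reflect (x i <= k /\ forall j, j != i ->
             2 * k + 1 <= x j + x i /\ x j <= 2 * k + 1 + x i)
          (in_pyramid i x).
Proof.
apply: (iffP andP) => -[xi xj]; split=> //.
  by move=> j ji; move/forallP: xj => /(_ j); rewrite ji => /andP.
by apply/forallP => j; apply/implyP => ji; apply/andP; apply: xj.
Qed.

(** In a pyramid every coordinate is at most [2 * k + 1 + k], so the bound [3 * k + 1] loses no
    point. *)
Definition pyr_point : Type :=
  {x : {ffun 'I_g -> 'I_(3 * k + 1).+1} | [exists i, in_pyramid i (fun j => x j)]}.
HB.instance Definition _ := Finite.on pyr_point.

Definition coord (v : pyr_point) (j : 'I_g) : nat := val v j.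

Lemma coord_inj u v : coord u =1 coord v -> u = v.
Proof. by move=> uv; apply/val_inj/ffunP => j; apply/val_inj/uv. Qed.

Lemma pyr_pointP v : exists i, in_pyramid i (coord v).
Proof. by case: v => x Px; case/existsP: (Px) => i; exists i. Qed.

Lemma pyr_point_of i y : in_pyramid i y -> exists v : pyr_point, coord v =1 y.
Proof.
move=> py; have [yi yj] := in_pyramidP _ _ py.
pose x : {ffun 'I_g -> 'I_(3 * k + 1).+1} := [ffun j => inord (y j)].
have xE j : x j = y j :> nat.
  rewrite ffunE inordK //; have [->|/yj] := eqVneq j i; lia.
have Px : [exists i, in_pyramid i (fun j => x j)].
  apply/existsP; exists i; apply/in_pyramidP; split=> [|j ji]; rewrite !xE //.
  exact: yj.
by exists (exist _ x Px).
Qed.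

Definition pyr_adj : rel pyr_point := fun u v => (u != v) &&
  [forall j, (coord u j <= (coord v j).+1) && (coord v j <= (coord u j).+1)].

Lemma pyr_adj_sym : symmetric pyr_adj.
Proof.
move=> u v; rewrite /pyr_adj eq_sym; congr (_ && _).
by apply: eq_forallb => j; rewrite andbC.
Qed.

Lemma pyr_adj_irrefl : irreflexive pyr_adj.
Proof. by move=> u; rewrite /pyr_adj eqxx. Qed.

Definition pyr_graph : sgraph := SGraph pyr_adj_sym pyr_adj_irrefl.

Lemma apex_in_pyramid i :
  in_pyramid i (fun j => if j == i then 0 else 2 * k + 1).
Proof.
apply/in_pyramidP; rewrite eqxx; split=> // j /negPf->; lia.
Qed.

Lemma apex_exists (i : 'I_g) : exists v : pyr_point,
  [forall j, coord v j == if j == i then 0 else 2 * k + 1].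
Proof.
have [v vE] := pyr_point_of _ _ (apex_in_pyramid i).
by exists v; apply/forallP=> j; rewrite vE.
Qed.

Definition apex i : pyr_graph := xchoose (apex_exists i).

Lemma coord_apex i j : coord (apex i) j = if j == i then 0 else 2 * k + 1.
Proof. by have /forallP/(_ j)/eqP := xchooseP (apex_exists i). Qed.

(** In a pyramid [i] other than [j], coordinate [j] is at least [2 * k + 1 - k], hence positive. So
    the point lies in pyramid [j] at height 0, where all windows are single points. *)
Lemma coord_eq0 (v : pyr_graph) j : coord v j = 0 -> v = apex j.
Proof.
move=> vj0; have [i /in_pyramidP[vi vl]] := pyr_pointP v.
have ij : i = j by apply/eqP; apply: contraT; rewrite eq_sym => /vl; lia.
move: vl; rewrite ij => vl; apply: coord_inj => l; rewrite coord_apex.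
by have [->|/vl] := eqVneq l j => //; lia.
Qed.

(** Provides the edge that brings a vertex closer to apex [j]; the other coordinates move by at most
    1, just enough to stay in some pyramid. *)
Lemma coord_descent_point i (x : 'I_g -> nat) j : in_pyramid i x -> 0 < x j ->
  exists i' y, [/\ in_pyramid i' y, y j = (x j).-1 &
    forall l, x l <= (y l).+1 /\ y l <= (x l).+1].
Proof.
case/in_pyramidP=> xi xl xj0; have [eji|ji] := eqVneq j i.
  (* Lowering the height shrinks every window by 1 at both ends, so coordinates lying on an end are
     pushed inwards. *)
  exists i, (fun l => if l == i then (x i).-1
    else if x l + x i == 2 * k + 1 then (x l).+1
    else if x l == 2 * k + 1 + x i then (x l).-1 else x l).
  rewrite eji in xj0 *; rewrite eqxx; split=> // [|l].
    apply/in_pyramidP; rewrite eqxx; split=> [|l li]; first by lia.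
    by rewrite (negPf li); have := xl l li; do 2?case: eqP; lia.
  by have [->|/xl] := eqVneq l i; do 2?case: eqP; lia.
have xj := xl j ji.
(* Off the lower end of its window, coordinate [j] can decrease alone. *)
have [lt|ge] := ltnP (2 * k + 1) (x j + x i).
  exists i, (fun l => if l == j then (x j).-1 else x l).
  rewrite eqxx; split=> // [|l]; last by case: eqP => [->|_]; lia.
  apply/in_pyramidP; rewrite eq_sym (negPf ji); split=> // l li.
  by have [_|_] := eqVneq l j; [lia | exact: xl].
(* At the lower end, raising the height [x i] widens the window, provided the height is below
   [k]. *)
have [ltk|gek] := ltnP (x i) k.
  exists i, (fun l => if l == j then (x j).-1
    else if l == i then (x i).+1 else x l).
  rewrite eqxx; split=> // [|l]; last by do 2?case: eqP => [->|_]; lia.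
  apply/in_pyramidP; rewrite eqxx eq_sym (negPf ji); split=> // l li.
  by rewrite (negPf li); case: eqP => _; have := xl l li; lia.
(* Here [x i = k] and [x j = k + 1]: the step crosses into pyramid [j]. *)
exists j, (fun l => if l == j then k else if l == i then k.+1 else x l).
rewrite eqxx; split=> [| |l]; first 2 last.
- by do 2?case: eqP => [->|_]; lia.
- apply/in_pyramidP; rewrite eqxx; split=> // l /negPf->.
  by have [_|/xl] := eqVneq l i; lia.
- lia.
Qed.

Lemma coord_descent (v : pyr_graph) j : 0 < coord v j ->
  exists2 u : pyr_graph, adj v u & coord u j = (coord v j).-1.
Proof.
move=> vj0; have [i pv] := pyr_pointP v.
have [i' [y [py yj vy]]] := coord_descent_point _ _ _ pv vj0.
have [u uE] := pyr_point_of _ _ py; exists u; last by rewrite uE.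
apply/andP; split; first by apply/eqP => vu; move: (uE j); rewrite -vu yj; lia.
by apply/forallP=> l; rewrite uE; apply/andP; apply: vy.
Qed.

(** * Coordinates as distances to the apices *)

Lemma walk_apex j (v : pyr_graph) : walk (coord v j) v (apex j).
Proof.
have [m vm] : exists m, coord v j = m by exists (coord v j).
rewrite vm; elim: m v vm => [|m IH] v vm.
  by apply/walkP; exists [::]; rewrite (coord_eq0 _ _ vm).
have [|u vu uj] := coord_descent v j; first by rewrite vm.
have /IH/walkP[p [up pj sp]] : coord u j = m by rewrite uj vm.
by apply/walkP; exists (u :: p); split; rewrite /= ?sp //; apply/andP.
Qed.

Lemma coord_walk n (u v : pyr_graph) j :
  walk n u v -> coord u j <= coord v j + n.
Proof.
case/walkP=> p [up <- <-]; elim: p u up => /= [|w p IH] u.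
  by rewrite addn0.
case/andP=> /andP[_ /forallP/(_ j)/andP[uw _]] /IH; lia.
Qed.

Lemma pyr_graph_connected : 0 < g -> connected pyr_graph.
Proof.
move=> g0 u v; pose w := apex (Ordinal g0).
have to_w z : connect (@adj pyr_graph) z w.
  have /walkP[p [zp zw _]] := walk_apex (Ordinal g0) z.
  by apply/connectP; exists p.
apply: connect_trans (to_w u) _.
by rewrite sym_connect_sym //; apply: adj_sym.
Qed.

Lemma gdist_apex (v : pyr_graph) j : gdist v (apex j) = coord v j.
Proof.
(* The index [j] itself witnesses [0 < g]. *)
have conn := pyr_graph_connected (leq_ltn_trans (leq0n j) (ltn_ord j)).
apply/eqP; rewrite eqn_leq gdist_le ?walk_apex //=.
have := coord_walk _ _ _ j (gdist_walk _ conn v (apex j)).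
by rewrite coord_apex eqxx.
Qed.

(** Distances to the apices are the coordinates: these determine a point, and in pyramid [i]
    coordinate [i] is at most [k]. *)
Lemma kresdominating_apex : kresdominating k [set apex i | i : 'I_g].
Proof.
apply/andP; split; last first.
  apply/forallP=> v; apply/implyP => _; have [i /andP[vi _]] := pyr_pointP v.
  by apply/existsP; exists (apex i); rewrite imset_f //= gdist_apex.
apply/forallP=> u; apply/forallP=> v; apply/implyP=> /andP[_].
apply: contra_neq => /eqP/dist_vector_eqP uv; apply: coord_inj => j.
by rewrite -!gdist_apex uv // imset_f.
Qed.

(** * Counting the lattice points *)

Lemma card_window (p : 'I_k.+1) :
  #|[pred y : 'I_(3 * k + 1).+1 | (2 * k + 1 <= y + p) && (y <= 2 * k + 1 + p)]|
    = 2 * p + 1.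
Proof.
have pk := ltn_ord p.
pose f (z : 'I_(2 * p).+1) : 'I_(3 * k + 1).+1 := inord (2 * k + 1 - p + z).
have fE z : f z = 2 * k + 1 - p + z :> nat.
  by rewrite inordK //; have := ltn_ord z; lia.
have f_inj : injective f.
  by move=> a b /(congr1 val) /=; rewrite !fE => ab; apply/val_inj => /=; lia.
have -> : 2 * p + 1 = #|f @: setT| by rewrite card_imset // cardsT card_ord addn1.
apply: eq_card => y.
rewrite inE; apply/andP/imsetP => [[ly yu]|[z _ ->]]; last first.
  by rewrite fE; have := ltn_ord z; lia.
have lt : y + p - (2 * k + 1) < (2 * p).+1 by lia.
by exists (Ordinal lt) => //; apply/ord_inj; rewrite fE /=; lia.
Qed.

(** The slice of pyramid [i] at height [p], given coordinate by coordinate so that its cardinality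
    is a product. *)
Definition layer (i : 'I_g) (p : 'I_k.+1) (j : 'I_g) :
    pred 'I_(3 * k + 1).+1 :=
  fun y => if j == i then y == p :> nat
  else (2 * k + 1 <= y + p) && (y <= 2 * k + 1 + p).

Lemma card_layer i p : #|family (layer i p)| = (2 * p + 1) ^ (g - 1).
Proof.
rewrite card_family foldrE big_map big_enum /= (bigD1 i) //= /layer eqxx.
rewrite (eq_card (B := pred1 (inord p : 'I_(3 * k + 1).+1))) => [|y]; last first.
  rewrite !inE; apply/eqP/eqP => [yp|->]; last first.
    by rewrite inordK; have := ltn_ord p; lia.
  by apply/val_inj; rewrite /= -yp inord_val.
rewrite card1 mul1n (eq_bigr (fun=> 2 * p + 1)) => [|j /negPf->]; last first.
  exact: card_window.
by rewrite prod_nat_const cardC1 card_ord subn1.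
Qed.

(** The layers are pairwise disjoint sets of vertices. An inequality suffices, since the general
    upper bound gives the converse. *)
Lemma card_pyr_graph :
  g + g * \sum_(1 <= p < k.+1) (2 * p + 1) ^ (g - 1) <= #|pyr_graph|.
Proof.
have -> : g + g * \sum_(1 <= p < k.+1) (2 * p + 1) ^ (g - 1)
    = \sum_(ip : 'I_g * 'I_k.+1) #|family (layer ip.1 ip.2)|.
  rewrite -(pair_bigA _ (fun i p => #|family (layer i p)|)) /=.
  under [RHS]eq_bigr do under eq_bigr do rewrite card_layer.
  rewrite sum_nat_const card_ord.
  (* The layer [p = 0] of each pyramid is its apex alone; these account for the summand [g]. *)
  rewrite -(big_mkord predT (fun p => (2 * p + 1) ^ (g - 1))) [in RHS]big_ltn //.
  by rewrite exp1n mulnDr muln1.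
rewrite card_sig -sum1_card.
under [leqLHS]eq_bigr do rewrite -sum1_card.
(* Double counting: it remains to see that each point lies in at most one layer. *)
rewrite (exchange_big_dep (fun x : {ffun 'I_g -> 'I_(3 * k + 1).+1} =>
    [exists i, in_pyramid i (fun j => x j)])) /=; last first.
  case=> i p x _ /familyP xF; apply/existsP; exists i; apply/in_pyramidP.
  have := xF i; rewrite /layer unfold_in eqxx => /eqP ->.
  split=> [|j /negPf ji]; first by rewrite -ltnS.
  by have := xF j; rewrite /layer unfold_in ji => /andP.
apply: leq_sum => x _; rewrite sum1_card; apply/card_le1_eqP.
have levelE i (p : 'I_k.+1) : x \in family (layer i p) -> p = x i :> nat.
  by move/familyP/(_ i); rewrite /layer unfold_in eqxx => /eqP.
case=> i p [i' p'] xip xip'.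
have xi := levelE i p xip; have xi' := levelE i' p' xip'.
(* Were the pyramids distinct, the window condition would give [2 * k + 1 <= p + p'], although both
   heights are at most [k]. *)
have ii' : i = i'.
  apply/eqP; apply: contraT => ne; move/familyP: xip' => /(_ i).
  rewrite /layer unfold_in (negPf ne) -xi /=.
  by have := ltn_ord p; have := ltn_ord p'; lia.
by rewrite ii' in xi *; congr (_, _); apply/val_inj; rewrite /= xi.
Qed.

End Pyramids.

Theorem theorem5p1 (k g : nat) (hk : 1 <= k) (hg : 1 <= g) :
  (forall G : sgraph, connected G -> gamma_r k G = g ->
     #|G| <= g + g * \sum_(1 <= p < k.+1) (2 * p + 1) ^ (g - 1)) /\
  (exists G : sgraph, [/\ connected G, gamma_r k G = g &
     #|G| = g + g * \sum_(1 <= p < k.+1) (2 * p + 1) ^ (g - 1)]).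
Proof.
have upper (G : sgraph) : connected G -> #|G| <= gamma_r k G +
    gamma_r k G * \sum_(1 <= p < k.+1) (2 * p + 1) ^ (gamma_r k G - 1).
  move=> conn; case: (gamma_rP k G) => -[D resD <-] _.
  exact: card_le_kresdominating.
split=> [G /upper le <- //|]; exists (pyr_graph k g).
have conn := pyr_graph_connected k g hg.
have lower := card_pyr_graph k g.
have eq_g : gamma_r k (pyr_graph k g) = g.
  apply/eqP; rewrite eqn_leq; apply/andP; split.
    have [_ /(_ _ (kresdominating_apex k g)) le] := gamma_rP k (pyr_graph k g).
    apply: leq_trans le _; apply: leq_trans (leq_imset_card _ _) _.
    by rewrite card_ord.
  rewrite leqNgt; apply/negP => lt.
  have := leq_trans lower (upper _ conn); rewrite leqNgt => /negP[].
  (* Strictness comes from the first summand alone; the products need only be compared weakly. *)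
  rewrite -addSn; apply: leq_add => //; apply: leq_mul; first exact: ltnW.
  by apply: leq_sum => p _; apply: leq_pexp2l; lia.
split=> //; apply/eqP; rewrite eqn_leq lower andbT.
by have := upper _ conn; rewrite eq_g.
Qed.
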